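(* Let $X$ be a Banach space. Then $X$ has weak normal structure if and only if $X$ has the weak fixed point property for mappings which diminish the radius of invariant convex subsets, i.e. for every nontrivial weakly compact convex subset $K$ of $X$, every self-mapping $T:K\to K$ which diminishes the radius of invariant convex subsets of $K$ has a fixed point in $K$.
   Context: Nontrivial means containing more than one point. For $x\in X$ and $A\subseteq X$, $r_x(A)=\sup\{\|x-y\|:y\in A\}$ and $\delta(A)=\sup\{\|x-y\|:x,y\in A\}$. A mapping $T:K\to K$ diminishes the radius of invariant convex subsets of $K$ if for every convex $A\subseteq K$ with $T(A)\subseteq A$, $r_{Tx}(T(A))\le r_x(A)$ for every $x\in K$. $X$ has weak normal structure if every nontrivial weakly compact convex subset $K$ of $X$ has normal structure: for every closed convex $K_0\subseteq K$ with $\delta(K_0)>0$ there is $x_0\in K_0$ with $r_{x_0}(K_0)<\delta(K_0)$. *)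

(* Defs.v *)
From HB Require Import structures.
From mathcomp Require Import all_boot all_order all_algebra.
From mathcomp Require Import all_classical all_reals all_analysis.
Set Implicit Arguments.
Unset Strict Implicit.
Unset Printing Implicit Defensive.
Import Order.TTheory GRing.Theory Num.Theory.
Import numFieldNormedType.Exports.
Local Open Scope classical_set_scope.
Local Open Scope ring_scope.

Section Defs.
Variables (R : realType) (X : completeNormedModType R).

Definition dual_index := {f : {linear X -> R} | continuous (f : X -> R)}.

(** The weak topology sigma(X, dual of X): the coarsest topology making every
    continuous linear functional continuous. *)
Definition weak_topology_of : Type :=
  sup_topology (fun f : dual_index =>
    Topological.class (initial_topology (fun x : X => (sval f : X -> R) x))).

Definition weakly_compact (K : set X) : Prop :=
  @compact weak_topology_of K.

Definition nontrivial (A : set X) : Prop :=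
  exists x y, A x /\ A y /\ x <> y.

Definition convex (A : set X) : Prop :=
  @convex_set R X A.

Definition radius_at (x : X) (A : set X) : R :=
  sup [set `|x - y| | y in A].

Definition diam (A : set X) : R :=
  sup [set `|x - y| | x in A & y in A].

Definition normal_structure (K : set X) : Prop :=
  forall K0 : set X, K0 `<=` K -> closed K0 -> convex K0 ->
    0 < diam K0 -> exists2 x0, K0 x0 & radius_at x0 K0 < diam K0.

Definition weak_normal_structure : Prop :=
  forall K : set X, nontrivial K -> weakly_compact K -> convex K ->
    normal_structure K.

(** T : K -> K (T given as a map on X sending K into K) diminishes the radius
    of invariant convex subsets of K *)
Definition diminishes_radius (K : set X) (T : X -> X) : Prop :=
  forall A : set X, A `<=` K -> convex A -> T @` A `<=` A ->
    forall x, K x -> radius_at (T x) (T @` A) <= radius_at x A.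

Definition weak_fpp_diminishing : Prop :=
  forall K : set X, nontrivial K -> weakly_compact K -> convex K ->
    forall T : X -> X, T @` K `<=` K -> diminishes_radius K T ->
      exists2 x, K x & T x = x.

End Defs.

(* Main.v *)
Require Import Defs.
From HB Require Import structures.
From mathcomp Require Import all_boot all_order all_algebra.
From mathcomp Require Import all_classical all_reals all_analysis.
From mathcomp Require Import ring lra.

(** Weak normal structure gives fixed points by Kirk's argument: weak
    compactness and Zorn's lemma yield a minimal closed convex [T]-invariant set
    [C].  If [C] had two points, normal structure would give a radius
    [r < diam C] and a point of [C] whose [r]-ball contains [C].  For every such
    point [x], the set of the [y] in [C] with [|T x - y| <= r] is invariant,
    hence equal to [C]; so the set of these points is invariant too, hence equal
    to [C], and [diam C <= r].

    Conversely, a diametral set contains a sequence [x n] with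
    [|z - x n| -> diam] for every [z] in a closed convex set containing the
    sequence.  The map sending [x n] to [x n.+1] and all other points to [x 0]
    has no fixed point there, and every nonempty invariant set contains a tail
    of the sequence, so it has the maximal radius around every point.

    Both directions use that closed convex sets are weakly closed, which is
    deduced from the existence of a linear functional below every sublinear
    one, and that weakly compact sets are bounded. *)

Set Implicit Arguments.
Unset Strict Implicit.
Unset Printing Implicit Defensive.
Import Order.TTheory GRing.Theory Num.Theory.
Import numFieldNormedType.Exports.
Local Open Scope classical_set_scope.
Local Open Scope ring_scope.

(** * Sublinear functionals and the Hahn-Banach theorem *)

Section Sublinear.
Variables (R : realType) (X : lmodType R).

Definition sublinear (p : X -> R) : Prop :=
  [/\ p 0 = 0, forall u v, p (u + v) <= p u + p v &
      forall t u, 0 < t -> p (t *: u) <= t * p u].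

Lemma sublinear_oppr p v : sublinear p -> - p (- v) <= p v.
Proof. by case=> p0 pD _; have := pD v (- v); rewrite subrr p0; lra. Qed.

(** The members [F i] need not be sublinear: each axiom may be met by moving to another index [k].
    This covers infima of chains as well as infima of difference quotients. The minorant [b] keeps
    [inf] away from its default value. *)
Lemma sublinear_inf (I : Type) (D : set I) (F : I -> X -> R) (b : X -> R) :
    D !=set0 -> (forall i u, D i -> b u <= F i u) ->
    (forall i, D i -> 0 <= F i 0) ->
    (forall e, 0 < e -> exists2 i, D i & F i 0 <= e) ->
    (forall i j u v, D i -> D j ->
       exists2 k, D k & F k (u + v) <= F i u + F j v) ->
    (forall i t u, D i -> 0 < t -> exists2 k, D k & F k (t *: u) <= t * F i u) ->
  sublinear (fun u => inf [set F i u | i in D]).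
Proof.
move=> [i0 Di0] Fb F0 Fe FD FZ.
have infle i u : D i -> inf [set F i u | i in D] <= F i u.
  move=> Di; apply: ge_inf; last by exists i.
  by exists (b u) => _ [j Dj <-]; exact: Fb.
have leinf m u : (forall i, D i -> m <= F i u) -> m <= inf [set F i u | i in D].
  move=> mF; apply: lb_le_inf; first by exists (F i0 u), i0.
  by move=> _ [i Di <-]; exact: mF.
split.
- apply/eqP; rewrite eq_le; apply/andP; split; last exact: leinf.
  apply/ler_addgt0Pr => e /Fe [i Di]; rewrite add0r.
  by apply: le_trans; exact: infle.
- move=> u v; rewrite -lerBlDr; apply: (leinf) => i Di.
  rewrite lerBlDr -lerBlDl; apply: leinf => j Dj.
  have [k Dk] := FD i j u v Di Dj; have := infle k (u + v) Dk; lra.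
- move=> t u t0; rewrite mulrC -ler_pdivrMr//; apply: (leinf) => i Di.
  rewrite ler_pdivrMr// mulrC.
  by have [k Dk] := FZ i t u Di t0; apply: le_trans; exact: infle.
Qed.

(** Zorn's lemma for the reversed pointwise order. A nonempty chain has its infimum as bound:
    [- p (- u)] minorizes it, and of two members the smaller one serves for subadditivity. *)
Lemma minimal_sublinear_exists p : sublinear p ->
  exists q, [/\ sublinear q, forall v, q v <= p v &
    forall q', sublinear q' -> (forall v, q' v <= q v) -> q' = q].
Proof.
move=> psub.
pose P (q : X -> R) := sublinear q /\ forall v, q v <= p v.
pose T := {q : X -> R | P q}.
pose below (q q' : T) := `[< forall v, sval q' v <= sval q v >].
have [|||A totA|[q [qsub qp]] qmin] := @Zorn T below.
- by move=> q; apply/asboolP.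
- move=> q1 q2 q3 /asboolP q12 /asboolP q23; apply/asboolP => v.
  exact: le_trans (q23 v) (q12 v).
- move=> [q1 q1P] [q2 q2P] /asboolP/= q12 /asboolP/= q21; apply: eq_exist.
  by apply/funext => v; apply/eqP; rewrite eq_le q21 q12.
- have [->|/set0P [q0 Aq0]] := eqVneq A set0.
    by exists (exist P p (conj psub (fun v => lexx _))).
  have Alb (q : T) u : A q -> - p (- u) <= sval q u.
    move=> _; case: q => q [qsub qp] /=; have := sublinear_oppr u qsub.
    by have := qp (- u); lra.
  have isub : sublinear (fun u => inf [set sval q u | q in A]).
    apply: (@sublinear_inf T A (fun q => sval q) (fun u => - p (- u))) => //.
    + by exists q0.
    + by move=> q _; have [[-> _ _] _] := svalP q.
    + by move=> e e0; exists q0 => //; have [[-> _ _] _] := svalP q0; exact: ltW.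
    + move=> q1 q2 u v A1 A2; have [/asboolP l12|/asboolP l21] := totA _ _ A1 A2.
        exists q2 => //; have [[_ qD _] _] := svalP q2.
        by have := l12 u; have := qD u v; lra.
      exists q1 => //; have [[_ qD _] _] := svalP q1.
      by have := l21 v; have := qD u v; lra.
    + by move=> q t u Aq t0; exists q => //; have [[_ _ qZ] _] := svalP q; exact: qZ.
  have ile (q : T) : A q -> forall u, inf [set sval q u | q in A] <= sval q u.
    move=> Aq u; apply: ge_inf; last by exists q.
    by exists (- p (- u)) => _ [q' Aq' <-]; exact: Alb.
  have ip u : inf [set sval q u | q in A] <= p u.
    exact: le_trans (ile _ Aq0 u) ((svalP q0).2 u).
  by exists (exist P _ (conj isub ip)) => q Aq; apply/asboolP; exact: ile.
- exists q; split=> // q' q'sub q'q.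
  have q'p v : q' v <= p v by exact: le_trans (q'q v) (qp v).
  by have /(congr1 sval) := qmin (exist P q' (conj q'sub q'p)) (asboolT q'q).
Qed.

(* For minimal q, comparing q with the sublinear functional
   u |-> inf_(t >= 0) (q (u + t v) - t q v) at u = - v shows that q is odd. *)
Lemma minimal_sublinear_odd q v : sublinear q ->
    (forall q', sublinear q' -> (forall v, q' v <= q v) -> q' = q) ->
  q (- v) = - q v.
Proof.
move=> qsub qmin; have [q0 qD qZ] := qsub.
have qZge t : 0 <= t -> t * q v <= q (t *: v).
  rewrite le_eqVlt => /predU1P [<-|t0]; first by rewrite scale0r q0 mul0r.
  rewrite mulrC -ler_pdivlMr// mulrC.
  by have := qZ t^-1 (t *: v); rewrite scalerA mulVf ?gt_eqF// scale1r; apply;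
    rewrite invr_gt0.
pose F t u := q (u + t *: v) - t * q v.
have Flb t u : 0 <= t -> - q (- u) <= F t u.
  move=> t0; rewrite /F; have := qZge t t0; have := qD (u + t *: v) (- u).
  by rewrite addrAC subrr add0r; lra.
have F0 u : F 0 u = q u by rewrite /F scale0r addr0 mul0r subr0.
have Fsub : sublinear (fun u => inf [set F t u | t in [set t | 0 <= t]]).
  apply: (@sublinear_inf R [set t | 0 <= t] F (fun u => - q (- u))) => //.
  - by exists 0 => /=.
  - by move=> t /= t0; rewrite /F add0r subr_ge0; exact: qZge.
  - by move=> e e0; exists 0 => //=; rewrite F0 q0 ltW.
  - move=> s t u w /= s0 t0; exists (s + t) => /=; first exact: addr_ge0.
    rewrite /F scalerDl mulrDl addrACA.
    by have := qD (u + s *: v) (w + t *: v); lra.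
  - move=> s t u /= s0 t0; exists (t * s) => /=; first by rewrite mulr_ge0 // ltW.
    rewrite /F -scalerA -scalerDr; have := qZ t (u + s *: v) t0; lra.
have Fle t u : 0 <= t -> inf [set F t u | t in [set t | 0 <= t]] <= F t u.
  move=> t0; apply: ge_inf; last by exists t.
  by exists (- q (- u)) => _ [s s0 <-]; exact: Flb.
have Fq : (fun u => inf [set F t u | t in [set t | 0 <= t]]) = q.
  by apply: qmin => // u; rewrite -[leRHS]F0; exact: Fle.
have := Fle 1 (- v) ler01.
rewrite (congr1 (@^~ (- v)) Fq) /F scale1r addNr q0 mul1r sub0r => le1.
apply/eqP; rewrite eq_le le1 /=; have := sublinear_oppr (- v) qsub.
by rewrite opprK.
Qed.

(** A minimal sublinear functional below [p] is odd, and oddness turns the inequalities of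
    sublinearity, applied to opposite vectors, into equalities. *)
Theorem hahn_banach_dominated p : sublinear p ->
  exists f : {linear X -> R^o}, forall v, f v <= p v.
Proof.
move=> /minimal_sublinear_exists [q [qsub qp qmin]].
have qN v : q (- v) = - q v by exact: minimal_sublinear_odd.
have [q0 qD qZ] := qsub.
have qDE u v : q (u + v) = q u + q v.
  apply/eqP; rewrite eq_le qD /=; have := qD (- u) (- v).
  by rewrite -opprD !qN; lra.
have qZE_pos t u : 0 < t -> q (t *: u) = t * q u.
  move=> t0; apply/eqP; rewrite eq_le qZ //=; have := qZ t (- u) t0.
  by rewrite scalerN !qN; lra.
have qZE t u : q (t *: u) = t * q u.
  have [t0|t0|->] := ltgtP t 0; [|exact: qZE_pos|by rewrite scale0r q0 mul0r].
  rewrite -[t in LHS]opprK scaleNr qN qZE_pos ?oppr_gt0//.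
  by rewrite mulNr opprK.
have qlin : linear (q : X -> R^o) by move=> t u v; rewrite qDE qZE.
pose q_linear := GRing.isLinear.Build R X R^o *:%R q qlin.
pose f : {linear X -> R^o} := HB.pack (q : X -> R^o) q_linear.
by exists f.
Qed.

End Sublinear.

(** * Convex combinations and separation of a point from a convex set *)

Lemma convexP (R : realType) (X : completeNormedModType R) (A : set X) :
  convex A <-> forall x y t, A x -> A y -> 0 <= t -> t <= 1 ->
    A (t *: x + (1 - t) *: y).
Proof.
split=> [cA x y t Ax Ay t0 t1|cA x y t /set_mem Ax /set_mem Ay].
  have := cA x y (@Itv01 R t t0 t1) (mem_set Ax) (mem_set Ay).
  by move/set_mem.
by apply: mem_set; apply: cA.
Qed.

Lemma convex_combination (R : realType) (X : completeNormedModType R)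
    (A : set X) (a b : R) x y :
    convex A -> A x -> A y -> 0 <= a -> 0 <= b -> 0 < a + b ->
  A ((a + b)^-1 *: (a *: x + b *: y)).
Proof.
move=> /convexP cA Ax Ay a0 b0 ab0.
have abn : a + b != 0 by rewrite gt_eqF.
have -> : (a + b)^-1 *: (a *: x + b *: y) =
    (a / (a + b)) *: x + (1 - a / (a + b)) *: y.
  rewrite scalerDr !scalerA; congr (_ *: _ + _ *: _); field; exact: abn.
apply: cA => //; first by rewrite divr_ge0 // ltW.
by rewrite ler_pdivrMr // mul1r lerDl.
Qed.

(* The functional is dominated by inf_(t > 0, c in C) (|x + t v - c| - d) / t,
   the directional derivative at x of the distance to C. *)
Lemma separation_of_distance (R : realType) (X : completeNormedModType R)
    (C : set X) (x : X) (d : R) :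
    C !=set0 -> convex C -> (forall c, C c -> d <= `|x - c|) ->
  exists f : {linear X -> R^o}, (forall v, f v <= `|v|) /\
    forall c, C c -> f c + d <= f x.
Proof.
move=> [c0 Cc0] cC Cd.
pose D := [set tc : R * X | 0 < tc.1 /\ C tc.2].
pose F (tc : R * X) v := (`|x + tc.1 *: v - tc.2| - d) / tc.1.
have Fge tc v : D tc -> - `|v| <= F tc v.
  case: tc => t c [/= t0 Cc]; rewrite /F /= ler_pdivlMr// mulNr lerNl opprB.
  have := Cd c Cc; have := ler_normB (x + t *: v - c) (t *: v).
  rewrite addrAC addrK normrZ gtr0_norm// => le1 le2.
  by rewrite mulrC; lra.
have Fsmall e v : 0 < e -> exists2 tc, D tc & F tc v <= `|v| + e.
  (* [F (t, c0) v] is at most [|v| + (|x - c0| - d) / t], so a large [t] suffices; the added 1 keeps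
     [t] positive when the distance is attained at [c0]. *)
  move=> e0; pose t := (`|x - c0| - d + 1) / e.
  have t0 : 0 < t by rewrite divr_gt0//; have := Cd _ Cc0; lra.
  exists (t, c0) => //; rewrite /F /= ler_pdivrMr// mulrDl.
  have -> : e * t = `|x - c0| - d + 1 by rewrite /t; field; rewrite gt_eqF.
  have := ler_normD (x - c0) (t *: v); rewrite normrZ gtr0_norm// addrAC.
  by rewrite [_ * t]mulrC; lra.
have Fsub : sublinear (fun v => inf [set F tc v | tc in D]).
  apply: (@sublinear_inf _ _ _ D F (fun v => - `|v|)) => //.
  - by exists (1, c0); split.
  - by move=> tc Dtc; have := Fge tc 0 Dtc; rewrite normr0 oppr0.
  - by move=> e e0; have := Fsmall e 0 e0; rewrite normr0 add0r.
  - move=> [s c] [t c'] u v [/= s0 Cc] [/= t0 Cc'].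
    have st0 : 0 < s + t by exact: addr_gt0.
    have stn : s + t != 0 by rewrite gt_eqF.
    (* Chosen with [1 / k = 1 / s + 1 / t]: weights [t / (s + t)] and [s / (s + t)] then give both
       [u] and [v] the coefficient [k]. *)
    pose k := s * t / (s + t).
    exists (k, (t + s)^-1 *: (t *: c + s *: c')).
      split=> /=; first by rewrite divr_gt0// mulr_gt0.
      by apply: convex_combination => //; [exact: ltW|exact: ltW|rewrite addrC].
    rewrite /F /=.
    have -> : x + k *: (u + v) - (t + s)^-1 *: (t *: c + s *: c') =
        (t / (s + t)) *: (x + s *: u - c) + (s / (s + t)) *: (x + t *: v - c').
      rewrite !scalerDr !scalerN !scalerA [t + s]addrC.
      rewrite -{1}[x]scale1r (_ : 1 = t / (s + t) + s / (s + t)); last first.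
        by field; exact: stn.
      rewrite scalerDl /k.
      rewrite (_ : t / (s + t) * s = s * t / (s + t)); last by ring.
      rewrite (_ : s / (s + t) * t = s * t / (s + t)); last by ring.
      rewrite ![(s + t)^-1 * _]mulrC opprD.
      set a := _ *: x; set b := _ *: x; set a' := _ *: u; set b' := _ *: v.
      by rewrite !addrA (AC (6)%AC (1*3*5*2*4*6)%AC).
    set U := x + s *: u - c; set V := x + t *: v - c'.
    rewrite ler_pdivrMr; last by rewrite divr_gt0// mulr_gt0.
    have -> : ((`|U| - d) / s + (`|V| - d) / t) * k =
        t / (s + t) * `|U| + s / (s + t) * `|V| - d.
      by rewrite /k; field; rewrite stn !gt_eqF.
    rewrite lerD2r; apply: le_trans (ler_normD _ _) _.
    by rewrite !normrZ (gtr0_norm s0) (gtr0_norm t0) gtr0_norm ?invr_gt0.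
  - move=> [s c] t u [/= s0 Cc] t0; exists (s / t, c).
      by split=> //=; rewrite divr_gt0.
    rewrite /F /= scalerA divfK ?gt_eqF// le_eqVlt; apply/orP; left; apply/eqP.
    by field; rewrite !gt_eqF.
have infle tc v : D tc -> inf [set F tc v | tc in D] <= F tc v.
  move=> Dtc; apply: ge_inf; last by exists tc.
  by exists (- `|v|) => _ [tc' D' <-]; exact: Fge.
have [f fp] := hahn_banach_dominated Fsub; exists f; split.
  move=> v; apply/ler_addgt0Pr => e e0; have [tc Dtc] := Fsmall e v e0.
  by apply: le_trans; exact: le_trans (fp v) (infle _ _ Dtc).
(* In direction [c - x] with [t = 1] the quotient equals [- d]. *)
move=> c Cc; have D1 : D (1, c) by split.
have := le_trans (fp (c - x)) (infle (1, c) (c - x) D1).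
rewrite /F /= scale1r [x + _]addrC subrK subrr normr0 divr1 linearB /=.
by set a := f c; set b := f x; rewrite sub0r; lra.
Qed.

Lemma linear_le_norm_continuous (R : realType) (X : normedModType R) (M : R)
    (f : {linear X -> R^o}) : (forall v, `|f v| <= M * `|v|) -> continuous f.
Proof.
move=> fM; apply/linear_bounded_continuous/linear_boundedP.
near=> r => v; apply: le_trans (fM v) _; apply: ler_wpM2r => //.
Unshelve. all: by end_near. Qed.

Lemma linear_norm_le (R : realType) (X : normedModType R)
    (f : {linear X -> R^o}) : (forall v, f v <= `|v|) -> forall v, `|f v| <= `|v|.
Proof.
move=> fle v; rewrite ler_norml fle andbT lerNl.
by have := fle (- v); rewrite linearN normrN.
Qed.

(** * Weak topology and closed convex sets *)

Section WeakTopology.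
Variables (R : realType) (X : completeNormedModType R).

Lemma weak_continuous (f : {linear X -> R^o}) : continuous f ->
  continuous (f : weak_topology_of X -> R).
Proof.
move=> cf x.
pose i : dual_index X := exist _ f cf.
have /(_ i) cvgi := (@cvg_sup X (dual_index X) _ (nbhs (x : weak_topology_of X))
   x (@nbhs_filter (weak_topology_of X) x)).1 cvg_id.
move=> A /(@initial_continuous X _ f x) /cvgi.
exact.
Qed.

Lemma closed_convex_separation (C : set X) (x : X) :
    closed C -> convex C -> C !=set0 -> ~ C x ->
  exists f : {linear X -> R^o}, exists2 d, 0 < d &
    continuous f /\ forall c, C c -> f c + d <= f x.
Proof.
move=> clC cC C0 nCx.
have : nbhs x (~` C) by apply: open_nbhs_nbhs; split=> //; exact: closed_openC.
move=> /nbhs_ballP [d /= d0 dC].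
have Cd c : C c -> d <= `|x - c|.
  move=> Cc; rewrite leNgt; apply/negP => xcd.
  by apply: (dC c) => //; rewrite -ball_normE.
have [f [fle fC]] := separation_of_distance C0 cC Cd.
exists f, d => //; split=> //; apply: (@linear_le_norm_continuous _ _ 1) => v.
by rewrite mul1r; exact: linear_norm_le.
Qed.

(** Mazur's theorem in filter form: if [x] were outside the norm-closed [C], the half-space where a
    separating [f] exceeds [f x - d] would be a weak neighbourhood of [x] missing [C]. *)
Lemma weak_cluster_closed_convex (C : set X)
    (F : set_system (weak_topology_of X)) (x : weak_topology_of X) :
    ProperFilter F -> closed C -> convex C -> F C -> cluster F x -> C x.
Proof.
move=> PF clC cC FC Fx; apply: contrapT => nCx.
have [f [d d0 [cf fC]]] := closed_convex_separation clC cC (filter_ex FC) nCx.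
have fx : nbhs (x : weak_topology_of X) (f @^-1` [set r | f x - d < r]).
  apply: (weak_continuous cf); apply: open_nbhs_nbhs; split.
    exact: open_gt.
  by rewrite /= ltrBlDr ltrDl.
by have [y [Cy /=]] := Fx _ _ FC fx; have := fC y Cy; lra.
Qed.

Lemma weakly_compact_sub (K C : set X) : weakly_compact K -> C `<=` K ->
  closed C -> convex C -> weakly_compact C.
Proof.
move=> wK CK clC cC F PF FC.
have [x [Kx Fx]] := wK F PF (filterS CK FC).
by exists x; split=> //; exact: (weak_cluster_closed_convex PF).
Qed.

Lemma weakly_compact_functional_bounded (K : set X) (f : {linear X -> R^o}) :
  weakly_compact K -> continuous f -> exists M, forall x, K x -> `|f x| <= M.
Proof.
move=> wK cf.
have := @continuous_compact (weak_topology_of X) R f K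
  (@continuous_subspaceT _ _ _ _ (weak_continuous cf)) wK.
move=> /compact_bounded [M [_ MP]]; exists (M + 1) => x Kx.
by apply: (MP (M + 1)) => //; rewrite ?ltrDl//; exists x.
Qed.

End WeakTopology.

(** * Boundedness of weakly compact sets *)

Section WeaklyCompactBounded.
Variables (R : realType) (X : completeNormedModType R).

(** Separation of [x] from [[set 0]], which lies at distance [|x|]. *)
Lemma norming_functional (x : X) : exists f : {linear X -> R^o},
  (forall v, `|f v| <= `|v|) /\ f x = `|x|.
Proof.
have [|||f [fle fx]] := @separation_of_distance R X [set 0] x `|x|.
- by exists 0.
- by apply/convexP => _ _ t -> -> _ _; rewrite !scaler0 addr0.
- by move=> _ ->; rewrite subr0.
- exists f; split; first exact: linear_norm_le.
  apply/eqP; rewrite eq_le fle /=.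
  by have := fx 0 erefl; rewrite linear0 add0r.
Qed.

(** Completeness of the dual, with the explicit rate [M] preserved in the limit for use in the
    gliding hump. *)
Lemma linear_limit (phi : nat -> X -> R) (M : nat -> R) :
    (forall n a u v, phi n (a *: u + v) = a * phi n u + phi n v) ->
    (forall m n v, (n <= m)%N -> `|phi m v - phi n v| <= M n * `|v|) ->
    M @ \oo --> 0 ->
  exists f : {linear X -> R^o}, forall n v, `|f v - phi n v| <= M n * `|v|.
Proof.
move=> philin phiM M0.
have Mge0 (v : X) e : 0 < e -> \forall n \near \oo, M n * `|v| < e.
  move=> e0; have : (fun n => M n * `|v|) @ \oo --> 0.
    by rewrite -(mul0r `|v|); apply: cvgM => //; exact: cvg_cst.
  move=> /cvgrPdist_lt /(_ e e0); apply: filterS => n.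
  by rewrite sub0r normrN; exact/le_lt_trans/ler_norm.
have phicvg v : cvg (phi ^~ v @ \oo).
  apply/cauchy_cvgP/cauchy_exP => e e0.
  have [n Mn] := filter_ex (Mge0 v e e0); exists (phi n v).
  apply: filterS (nbhs_infty_ge n) => m /= nm; rewrite -ball_normE /= distrC.
  exact: le_lt_trans (phiM _ _ _ nm) Mn.
pose f v := lim (phi ^~ v @ \oo).
have flin : linear (f : X -> R^o).
  move=> a u v; apply/cvg_lim => //.
  rewrite (_ : phi ^~ _ = fun n => a * phi n u + phi n v); last first.
    by apply/funext => n; exact: philin.
  by apply: cvgD => //; apply: cvgM => //; exact: cvg_cst.
pose f_linear := GRing.isLinear.Build R X R^o *:%R f flin.
pose F : {linear X -> R^o} := HB.pack (f : X -> R^o) f_linear.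
exists F => n v; apply/ler_addgt0Pr => e e0.
have /cvgrPdist_lt /(_ e e0) fphi := phicvg v.
have [m [/= fm nm]] := filter_ex (filterI fphi (nbhs_infty_ge n)).
rewrite -(subrKA (phi m v)) addrC; apply: le_trans (ler_normD _ _) _.
by apply: lerD; [exact: phiM|exact: ltW].
Qed.

(* A gliding hump: each increment has the sign that makes it reinforce the
   value of the partial sum at [x n], and the later ones cannot cancel it. *)
Lemma gliding_hump (x : nat -> X) : exists f : {linear X -> R^o},
  continuous f /\ forall n, 3^-1 ^+ n * `|x n| / 2 <= `|f (x n)|.
Proof.
have [g gP] := choice (fun n => norming_functional (x n)).
(* With ratio 1/3 the increments after step [n] sum to at most [q ^+ n / 2], so at least half of the
   hump [q ^+ n * |x n|] survives. *)
pose q : R := 3^-1.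
pose sg (y : R) : R := if 0 <= y then 1 else - 1.
pose fix phi (n : nat) : X -> R := if n is k.+1 then
  fun v => phi k v + sg (phi k (x k)) * q ^+ k * g k v else fun=> 0.
have q0 : 0 < q by rewrite invr_gt0.
have qn0 n : 0 < q ^+ n by exact: exprn_gt0.
have sg1 y : `|sg y| = 1 by rewrite /sg; case: ifP; rewrite ?normrN normr1.
have philin n a u v : phi n (a *: u + v) = a * phi n u + phi n v.
  elim: n => [|n IH] /=; first by rewrite mulr0 addr0.
  by rewrite IH linearP /= /GRing.scale /=; ring.
have phi_step n v : `|phi n.+1 v - phi n v| <= q ^+ n * `|v|.
  rewrite /= addrAC subrr add0r !normrM sg1 mul1r (gtr0_norm (qn0 n)).
  by rewrite ler_pM2l//; have [] := gP n.
have phiM n k v :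
    `|phi (n + k)%N v - phi n v| <= 3 / 2 * (q ^+ n - q ^+ (n + k)) * `|v|.
  elim: k => [|k IH]; first by rewrite addn0 !subrr normr0 mulr0 mul0r.
  rewrite addnS -(subrKA (phi (n + k)%N v)).
  apply: le_trans (ler_normD _ _) _; apply: le_trans (lerD (phi_step _ _) IH) _.
  rewrite -mulrDl ler_wpM2r// exprS /q; lra.
have [|m n v nm||f fP] := @linear_limit phi (fun n => 3 / 2 * q ^+ n).
- exact: philin.
- rewrite -(subnKC nm); apply: le_trans (phiM _ _ _) _.
  by apply: ler_wpM2r => //; have := qn0 (n + (m - n))%N; lra.
- rewrite -(mulr0 (3 / 2)); apply: cvgM; first exact: cvg_cst.
  by apply: cvg_expr; rewrite gtr0_norm// /q invf_lt1 ?ltr1n.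
exists f; split.
  apply: (@linear_le_norm_continuous _ _ (3 / 2)) => v.
  by have := fP 0%N v; rewrite /= subr0 expr0 mulr1.
move=> n; have := fP n.+1 (x n); set y := phi n.+1 (x n) => fy.
have : q ^+ n * `|x n| <= `|y|.
  rewrite /y /= /sg; have [_ ->] := gP n.
  have z0 := mulr_ge0 (ltW (qn0 n)) (normr_ge0 (x n)).
  have [p0|p0] := leP 0 (phi n (x n)); rewrite ?mulN1r ?mul1r ?mulNr.
    by rewrite ger0_norm ?addr_ge0// lerDr.
  by rewrite ler0_norm; lra.
have := ler_normD (f (x n)) (y - f (x n)); rewrite addrC subrK distrC.
move: fy; rewrite exprS.
have -> : 3 / 2 * (q * q ^+ n) * `|x n| = q ^+ n * `|x n| / 2.
  by rewrite /q; field.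
rewrite -/q; set z := q ^+ n * _; lra.
Qed.

(** In an unbounded [K], points with [|x n| > 2 n 3^n] exist, and the gliding hump functional
    exceeds [n] in absolute value at [x n], although it is bounded on [K]. *)
Lemma weakly_compact_bounded (K : set X) : weakly_compact K ->
  exists M, forall x, K x -> `|x| <= M.
Proof.
move=> wK; apply: contrapT => nM.
have /choice [x xP] n : exists x, K x /\ (2 * n%:R) * 3 ^+ n < `|x|.
  apply: contrapT => nx; apply: nM; exists ((2 * n%:R) * 3 ^+ n) => y Ky.
  by rewrite leNgt; apply/negP => ny; apply: nx; exists y.
have [f [cf fx]] := gliding_hump x.
have [M fM] := weakly_compact_functional_bounded wK cf.
pose n := Num.trunc M; have [Kx xn] := xP n.+1.
have := le_trans (fx n.+1) (fM _ Kx).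
have : M < n.+1%:R by exact: truncnS_gt.
suff : n.+1%:R <= 3^-1 ^+ n.+1 * `|x n.+1| / 2 by lra.
rewrite ler_pdivlMr// exprVn [_^-1 * _]mulrC ler_pdivlMr ?exprn_gt0//.
by rewrite [_ * 2]mulrC ltW.
Qed.

End WeaklyCompactBounded.

(** * Closed convex sets, radii and diameters *)

Section ClosedConvexSets.
Variables (R : realType) (X : completeNormedModType R).
Implicit Types (A C K : set X) (x y z : X).

Lemma closure_normP A x :
  closure A x <-> forall e, 0 < e -> exists2 y, A y & `|x - y| < e.
Proof.
split=> [clAx e e0|Ae B /nbhs_ballP [e /= e0 eB]].
  have [y [Ay]] := clAx _ (nbhsx_ballx x e e0); rewrite -ball_normE => xy.
  by exists y.
have [y Ay xy] := Ae e e0; exists y; split=> //.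
by apply: eB; rewrite -ball_normE.
Qed.

Lemma norm_convex_comb_le x y (t r : R) : 0 <= t -> t <= 1 ->
  `|x| <= r -> `|y| <= r -> `|t *: x + (1 - t) *: y| <= r.
Proof.
move=> t0 t1 xr yr; apply: le_trans (ler_normD _ _) _.
have t1' : 0 <= 1 - t by rewrite subr_ge0.
rewrite !normrZ (ger0_norm t0) (ger0_norm t1').
have := ler_wpM2l t0 xr; have := ler_wpM2l t1' yr; lra.
Qed.

Lemma closed_norm_ball z (r : R) : closed [set y | `|z - y| <= r].
Proof.
move=> y /closure_normP yr; apply/ler_addgt0Pr => e /yr [y' /= zy' yy'].
rewrite -(subrKA y'); apply: le_trans (ler_normD _ _) _; apply: lerD => //.
by rewrite distrC ltW.
Qed.

Lemma convex_comb_sub z x y (t : R) :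
  z - (t *: x + (1 - t) *: y) = t *: (z - x) + (1 - t) *: (z - y).
Proof.
rewrite !scalerBr opprD addrACA -scalerDl.
by rewrite (_ : t + (1 - t) = 1) ?scale1r//; ring.
Qed.

Lemma convex_norm_ball z (r : R) : convex [set y | `|z - y| <= r].
Proof.
apply/convexP => x y t /= xr yr t0 t1; rewrite convex_comb_sub.
exact: norm_convex_comb_le.
Qed.

Lemma convex_setI A C : convex A -> convex C -> convex (A `&` C).
Proof.
move=> /convexP cA /convexP cC; apply/convexP => x y t [Ax Cx] [Ay Cy] t0 t1.
by split; [exact: cA|exact: cC].
Qed.

Lemma convex_closure A : convex A -> convex (closure A).
Proof.
move=> /convexP cA; apply/convexP => x y t /closure_normP clx /closure_normP cly.
move=> t0 t1; apply/closure_normP => e e0.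
have e20 : 0 < e / 2 by rewrite divr_gt0.
have [x' Ax' xx'] := clx _ e20; have [y' Ay' yy'] := cly _ e20.
exists (t *: x' + (1 - t) *: y'); first exact: cA.
have -> : t *: x + (1 - t) *: y - (t *: x' + (1 - t) *: y') =
    t *: (x - x') + (1 - t) *: (y - y').
  by rewrite opprD addrACA !scalerBr.
apply: (@le_lt_trans _ _ (e / 2)); last lra.
by apply: norm_convex_comb_le => //; exact: ltW.
Qed.

(** The norm neighbourhoods of a closure point [x], traced on [K], have a weak cluster point in [K].
    It lies in every closed ball around [x], these being closed and convex, so it is [x]. *)
Lemma weakly_compact_closed K : weakly_compact K -> closed K.
Proof.
move=> wK x clKx; pose F := within K (nbhs x).
have PF : ProperFilter F by exact: within_nbhs_proper.
have FK : F K by exact: withinT.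
have [y [Ky Fy]] := wK F PF FK.
suff <- : y = x by [].
apply/esym/subr0_eq/normr0_eq0/eqP; rewrite eq_le normr_ge0 andbT.
apply/ler_addgt0Pr => e e0; rewrite add0r.
apply: (weak_cluster_closed_convex PF (@closed_norm_ball x e)
  (@convex_norm_ball x e)) => //.
apply: filterS (nbhsx_ballx x e e0) => z; rewrite -ball_normE /= => xz _.
exact: ltW.
Qed.

(** The bound [M] ensures that [sup] is a genuine supremum and not its default value. *)
Lemma radius_at_ge A x y (M : R) : (forall z, A z -> `|z| <= M) -> A y ->
  `|x - y| <= radius_at x A.
Proof.
move=> AM Ay; apply: ub_le_sup; last by exists y.
exists (`|x| + M) => _ [z Az <-]; apply: le_trans (ler_normB _ _) _.
by rewrite lerD2l; exact: AM.
Qed.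

Lemma radius_at_le A x (r : R) : A !=set0 -> (forall y, A y -> `|x - y| <= r) ->
  radius_at x A <= r.
Proof.
move=> [y0 Ay0] Ar; apply: ge_sup; first by exists `|x - y0|, y0.
by move=> _ [y Ay <-]; exact: Ar.
Qed.

Lemma diam_ge A x y (M : R) : (forall z, A z -> `|z| <= M) -> A x -> A y ->
  `|x - y| <= diam A.
Proof.
move=> AM Ax Ay; apply: ub_le_sup; last by exists x => //; exists y.
exists (M + M) => _ [u Au [v Av <-]]; apply: le_trans (ler_normB _ _) _.
by apply: lerD; exact: AM.
Qed.

Lemma diam_le A (r : R) : A !=set0 ->
  (forall x y, A x -> A y -> `|x - y| <= r) -> diam A <= r.
Proof.
move=> [y0 Ay0] Ar; apply: ge_sup; first by exists `|y0 - y0|, y0 => //; exists y0.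
by move=> _ [x Ax [y Ay <-]]; exact: Ar.
Qed.

End ClosedConvexSets.

(** * From weak normal structure to fixed points *)

Section FixedPoint.
Variables (R : realType) (X : completeNormedModType R).

Definition closed_convex_invariant (K : set X) (T : X -> X) (C : set X) : Prop :=
  [/\ C `<=` K, closed C, convex C, C !=set0 & T @` C `<=` C].

(** A nonempty chain generates a proper filter; its weak cluster point in [K] belongs to every
    member, so the intersection is nonempty. *)
Lemma minimal_invariant_exists (K : set X) (T : X -> X) :
    weakly_compact K -> convex K -> K !=set0 -> T @` K `<=` K ->
  exists2 C, closed_convex_invariant K T C &
    forall C', closed_convex_invariant K T C' -> C' `<=` C -> C' = C.
Proof.
move=> wK cK K0 TK; pose P := closed_convex_invariant K T.
have PK : P K by split=> //; exact: weakly_compact_closed.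
pose le (C C' : {C | P C}) := `[< sval C' `<=` sval C >].
have [|||A totA|[C PC] Cmin] := @Zorn {C | P C} le.
- by move=> C; apply/asboolP.
- move=> C1 C2 C3 /asboolP C12 /asboolP C23; apply/asboolP.
  exact: subset_trans C23 C12.
- move=> [C1 P1] [C2 P2] /asboolP/= C12 /asboolP/= C21; apply: eq_exist.
  by apply/seteqP.
- have [->|/set0P [C0 AC0]] := eqVneq A set0; first by exists (exist P K PK).
  pose I := [set x | forall C, A C -> sval C x].
  suff PI : P I.
    by exists (exist P I PI) => C AC; apply/asboolP => x; exact.
  pose F := filter_from A sval.
  have FF : Filter F.
    apply: filter_from_filter; first by exists C0.
    move=> C1 C2 A1 A2; have [/asboolP C12|/asboolP C21] := totA _ _ A1 A2.
      by exists C2 => // x C2x; split=> //; exact: C12.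
    by exists C1 => // x C1x; split=> //; exact: C21.
  have PF : ProperFilter F.
    by apply: filter_from_proper => C _; have [] := svalP C.
  have FA C : A C -> F (sval C) by exists C.
  split.
  + by move=> x Ix; have [CK _ _ _ _] := svalP C0; exact/CK/Ix.
  + move=> x clIx C AC; have [_ clC _ _ _] := svalP C; apply: clC.
    by apply: closureS clIx => y; exact.
  + apply/convexP => x y t Ix Iy t0 t1 C AC.
    by have [_ _ /convexP cC _ _] := svalP C; apply: cC => //; [exact: Ix|exact: Iy].
  + have [C0K _ _ _ _] := svalP C0.
    have [x [Kx Fx]] := wK F PF (filterS C0K (FA _ AC0)).
    exists x => C AC; have [_ clC cC _ _] := svalP C.
    exact: (weak_cluster_closed_convex PF clC cC (FA _ AC) Fx).
  + move=> _ [x Ix <-] C AC; have [_ _ _ _ TC] := svalP C.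
    by apply: TC; exists x => //; exact: Ix.
- exists C => // C' PC' C'C.
  by have /(congr1 sval) := Cmin (exist P C' PC') (asboolT C'C).
Qed.

(** Every point [c] of the minimal set is fixed: [T c <> c] would make [diam C] positive and bring
    normal structure into play. *)
Lemma weak_normal_structure_fpp :
  weak_normal_structure X -> weak_fpp_diminishing X.
Proof.
move=> wns K ntK wK cK T TK Tdim.
have K0 : K !=set0 by have [x [_ [Kx _]]] := ntK; exists x.
have [C [CK clC cC [c Cc] TC] Cmin] := minimal_invariant_exists wK cK K0 TK.
have [M KM] := weakly_compact_bounded wK.
have CM x : C x -> `|x| <= M by move=> /CK; exact: KM.
have TCx x : C x -> C (T x) by move=> Cx; apply: TC; exists x.
exists c; first exact: CK.
apply: contrapT => Tcc.
have dC : 0 < diam C.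
  apply: lt_le_trans (diam_ge CM (TCx _ Cc) Cc).
  by rewrite normr_gt0 subr_eq0; apply/eqP.
have [x0 Cx0 rd] := wns K ntK wK cK C CK clC cC dC.
set r := radius_at x0 C in rd.
have C_small x : C x -> (forall y, C y -> `|x - y| <= r) ->
    forall y, C y -> `|T x - y| <= r.
  move=> Cx xr.
  pose B := C `&` [set y | `|T x - y| <= r].
  have TB y : C y -> B (T y).
    move=> Cy; split=> /=; first exact: TCx.
    (* The hypothesis on [T] enters here, for the invariant set [C] itself. *)
    apply: (@le_trans _ _ (radius_at (T x) (T @` C))).
      by apply: (@radius_at_ge _ _ _ _ _ M); [move=> _ [z Cz <-]; exact/CM/TCx|exists y].
    apply: le_trans (Tdim C CK cC TC x (CK _ Cx)) _.
    by apply: radius_at_le => //; exists c.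
  suff -> : C = B by move=> y [].
  apply/esym/Cmin; last by move=> y [].
  split.
  - by move=> y [/CK].
  - by apply: closedI => //; exact: closed_norm_ball.
  - by apply: convex_setI => //; exact: convex_norm_ball.
  - by exists (T c); exact: TB.
  - by move=> _ [y [Cy _] <-]; exact: TB.
(* [A] is the intersection of [C] with the closed [r]-balls centred at the points of [C], hence
   closed and convex. *)
pose A := [set x | C x /\ forall y, C y -> `|x - y| <= r].
have AC : A = C.
  apply: Cmin; last by move=> x [].
  split.
  - by move=> x [/CK].
  - move=> x clAx; split; first by apply: clC; apply: closureS clAx => y [].
    move=> y Cy; rewrite distrC; apply: (@closed_norm_ball _ _ y r).
    by apply: closureS clAx => z [_ zr] /=; rewrite distrC; exact: zr.
  - apply/convexP => x y t [Cx xr] [Cy yr] t0 t1; split.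
      by move/convexP: cC; apply.
    move=> z Cz; rewrite distrC convex_comb_sub.
    by apply: norm_convex_comb_le => //; rewrite distrC; [exact: xr|exact: yr].
  - by exists x0; split=> // y; exact: (radius_at_ge _ CM).
  - by move=> _ [x [Cx xr] <-]; split; [exact: TCx|exact: C_small].
have : diam C <= r.
  by apply: diam_le => [|x y]; [exists c|rewrite -{1}AC => -[_]; exact].
by rewrite leNgt rd.
Qed.

End FixedPoint.

(** * Diametral sequences and a fixed-point-free map *)

Section Diametral.
Variables (R : realType) (X : completeNormedModType R) (K : set X) (M d : R).
Hypotheses (cK : convex K) (KM : forall x, K x -> `|x| <= M) (d0 : 0 < d).
Hypothesis Kdiam : forall x y, K x -> K y -> `|x - y| <= d.
Hypothesis Krad : forall x, K x -> d <= radius_at x K.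

(** [K] stands for a set on which normal structure fails and [d] for its diameter: every point then
    has radius at least [d]. *)
Lemma diametral_partner x e : K x -> 0 < e -> exists2 y, K y & d - e < `|x - y|.
Proof.
move=> Kx e0; have hs : has_sup [set `|x - y| | y in K].
  split; first by exists `|x - x|, x.
  by exists d => _ [y Ky <-]; exact: Kdiam.
have [_ [y Ky <-] xy] := sup_adherent e0 hs; exists y => //.
by apply: le_lt_trans xy; rewrite lerD2r; exact: Krad.
Qed.

(* [s n] is the sum of [x 0, ..., x n]; every new term is nearly diametral to
   the centroid of the preceding ones. *)
Lemma diametral_sequence_exists a : K a -> exists x s : nat -> X,
  [/\ s 0%N = x 0%N, forall n, s n.+1 = s n + x n.+1, forall n, K (x n),
      forall n, K (n.+1%:R^-1 *: s n) &
      forall n, d - d / n.+2%:R / n.+1%:R < `|n.+1%:R^-1 *: s n - x n.+1|].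
Proof.
move=> Ka.
(* The tolerance still tends to 0 after multiplication by [n + 1], the number of terms in [s n]. *)
have /choice [g gP] (ny : nat * X) : exists x, K ny.2 ->
    K x /\ d - d / ny.1.+2%:R / ny.1.+1%:R < `|ny.2 - x|.
  case: ny => n y /=; have [Ky|nKy] := pselect (K y); last by exists 0.
  have [|x Kx yx] := @diametral_partner y (d / n.+2%:R / n.+1%:R) Ky.
    by rewrite !divr_gt0.
  by exists x.
pose fix s (n : nat) : X :=
  if n is k.+1 then s k + g (k, k.+1%:R^-1 *: s k) else a.
pose x (n : nat) : X := if n is k.+1 then g (k, k.+1%:R^-1 *: s k) else a.
have Ks n : K (n.+1%:R^-1 *: s n).
  elim: n => [|n IH]; first by rewrite invr1 scale1r.
  have [Kx _] := gP (n, n.+1%:R^-1 *: s n) IH.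
  have := convex_combination cK IH Kx (ler0n R n.+1) ler01.
  by rewrite natr1 scalerA divff ?scale1r ?pnatr_eq0//; apply; rewrite ltr0n.
exists x, s; split=> //.
  by case=> [|n] //=; have [] := gP (n, n.+1%:R^-1 *: s n) (Ks n).
by move=> n; have [] := gP (n, n.+1%:R^-1 *: s n) (Ks n).
Qed.

Section Sequence.
Variables x s : nat -> X.
Hypotheses (s0 : s 0%N = x 0%N) (sS : forall n, s n.+1 = s n + x n.+1).
Hypotheses (Kx : forall n, K (x n)) (Ks : forall n, K (n.+1%:R^-1 *: s n)).
Hypothesis s_far :
  forall n, d - d / n.+2%:R / n.+1%:R < `|n.+1%:R^-1 *: s n - x n.+1|.

(* A convex set containing [x 0, ..., x n] on which the estimate for the
   centroid [s n / (n + 1)] still says something; it stands in for their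
   convex hull. *)
Definition centroid_star n : set X :=
  [set z | K z /\ exists2 u, K u & s n = z + n%:R *: u].

Lemma centroid_star_convex n : convex (centroid_star n).
Proof.
move/convexP: (cK) => cK'; apply/convexP => y z t [Ky [u Ku su]] [Kz [v Kv sv]].
move=> t0 t1; split; first exact: cK'.
exists (t *: u + (1 - t) *: v); first exact: cK'.
have -> : s n = t *: s n + (1 - t) *: s n.
  by rewrite -scalerDl (_ : t + (1 - t) = 1) ?scale1r//; ring.
rewrite {1}su sv scalerDr [(1 - t) *: (_ + _)]scalerDr addrACA scalerDr !scalerA.
by rewrite ![n%:R * _]mulrC.
Qed.

(** The new witness averages [u], with weight [n], and [x n.+1], with weight 1. *)
Lemma centroid_starS n : centroid_star n `<=` centroid_star n.+1.
Proof.
move=> z [Kz [u Ku su]]; split=> //.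
have n0 : 0 < n%:R + 1 :> R by rewrite natr1 ltr0n.
exists ((n%:R + 1)^-1 *: (n%:R *: u + 1 *: x n.+1)).
  by apply: convex_combination.
by rewrite natr1 scalerA divff ?pnatr_eq0// !scale1r sS su addrA.
Qed.

Lemma centroid_star_mono m n : (n <= m)%N -> centroid_star n `<=` centroid_star m.
Proof.
move=> /subnKC <-; elim: (m - n)%N => [|k IH]; first by rewrite addn0.
by rewrite addnS; exact: subset_trans IH (@centroid_starS _).
Qed.

Lemma centroid_star_term n : centroid_star n (x n).
Proof.
split=> //; case: n => [|n]; first by exists (x 0%N); rewrite // scale0r addr0.
exists (n.+1%:R^-1 *: s n) => //.
by rewrite scalerA divff ?pnatr_eq0// scale1r sS addrC.
Qed.

(** As [s n = z + n u], the distance from the centroid to [x n.+1], times [n + 1], is at most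
    [|z - x n.+1| + n d]; by choice of [x n.+1] it is at least [(n + 1) d - d / (n + 2)]. *)
Lemma centroid_star_far n z : centroid_star n z -> d - d / n.+2%:R <= `|z - x n.+1|.
Proof.
move=> [Kz [u Ku su]].
have N0 : 0 < n.+1%:R :> R by rewrite ltr0n.
have := s_far n; set y := _ *: s n - _ => far.
have : n.+1%:R * `|y| <= `|z - x n.+1| + n%:R * `|u - x n.+1|.
  have -> : n.+1%:R * `|y| = `|(z - x n.+1) + n%:R *: (u - x n.+1)|.
    rewrite -{1}(gtr0_norm N0) -normrZ /y scalerBr scalerA divff ?gt_eqF//.
    rewrite scale1r su -natr1 scalerDl scale1r scalerBr opprD.
    by rewrite [- (_ *: x _) - _]addrC addrACA.
  apply: le_trans (ler_normD _ _) _; rewrite lerD2l.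
  by rewrite normrZ ger0_norm.
have := ler_wpM2l (ler0n R n) (Kdiam Ku (Kx n.+1)).
have : n.+1%:R * (d - d / n.+2%:R / n.+1%:R) <= n.+1%:R * `|y|.
  by rewrite ler_pM2l// ltW.
have -> : n.+1%:R * (d - d / n.+2%:R / n.+1%:R) = n%:R * d + d - d / n.+2%:R.
  rewrite mulrBr [n.+1%:R * (_ / _)]mulrC divfK ?gt_eqF//.
  by rewrite -{1}(natr1 n) mulrDl mul1r.
move: (d / _) (n.+1%:R * _) (n%:R * d) (n%:R * _) => q a b c; lra.
Qed.

(** Earlier terms lie in the star preceding a later term, so their distance to it is positive. *)
Lemma diametral_sequence_inj : injective x.
Proof.
have lt_neq i j : (i < j)%N -> x i <> x j.
  case: j => // j; rewrite ltnS => ij xij.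
  have := centroid_star_far (centroid_star_mono ij (@centroid_star_term i)).
  rewrite xij subrr normr0 leNgt => /negP; apply.
  by rewrite subr_gt0 ltr_pdivrMr ?ltr0n// ltr_pMr// ltr1n.
move=> i j xij; apply/eqP; have [] := ltngtP i j => // ij.
  by case: (lt_neq _ _ ij).
by case: (lt_neq _ _ ij).
Qed.

(** Substitute for the closed convex hull of the sequence; the union is convex because the stars
    increase. *)
Definition star_closure : set X := closure (\bigcup_n centroid_star n).

Lemma star_closure_convex : convex star_closure.
Proof.
apply: convex_closure; apply/convexP => y z t [m _ my] [n _ nz] t0 t1.
exists (maxn m n) => //; have /convexP := @centroid_star_convex (maxn m n).
apply=> //; first exact: centroid_star_mono (leq_maxl m n) _ my.
exact: centroid_star_mono (leq_maxr m n) _ nz.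
Qed.

Lemma star_closure_term n : star_closure (x n).
Proof. by apply: subset_closure; exists n => //; exact: centroid_star_term. Qed.

Lemma star_closure_radius (A : set X) z : A `<=` K -> star_closure z ->
  (exists k, forall n, (k <= n)%N -> A (x n)) -> d <= radius_at z A.
Proof.
move=> AK /closure_normP clz [k Ax]; apply/ler_addgt0Pr => e e0.
have e20 : 0 < e / 2 by rewrite divr_gt0.
have [y [n _ ny] zy] := clz _ e20.
(* The summands respectively put [y] in [centroid_star m], put [x m.+1] in [A], and make [d / m.+2]
   at most [e / 2]. *)
pose m := (n + k + Num.trunc (d / (e / 2)))%N.
have Am : A (x m.+1) by apply: Ax; apply: leqW; rewrite /m addnAC leq_addl.
have AM u : A u -> `|u| <= M by move=> /AK; exact: KM.
have := radius_at_ge z AM Am.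
have /centroid_star_far : centroid_star m y.
  by apply: centroid_star_mono ny; rewrite /m -addnA leq_addr.
have dm : d / m.+2%:R <= e / 2.
  rewrite ler_pdivrMr ?ltr0n// mulrC -ler_pdivrMr//.
  apply: le_trans (ltW (truncnS_gt _)) _; rewrite ler_nat.
  by apply: leqW; rewrite ltnS leq_addl.
have : `|y - x m.+1| <= `|z - y| + `|z - x m.+1|.
  by rewrite [`|z - y|]distrC -(subrKA z); exact: ler_normD.
move: dm; set q := d / _; lra.
Qed.

(* [T] shifts the sequence and sends every other point to [x 0]; an invariant
   nonempty set contains a tail of the sequence, hence has radius [d] around
   every point of [star_closure]. *)
Lemma fixed_point_free_shift : closed K -> exists T : X -> X,
  [/\ T @` star_closure `<=` star_closure, diminishes_radius star_closure T &
      forall z, T z <> z].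
Proof.
move=> clK.
have SK : star_closure `<=` K.
  by move=> z clz; apply: clK; apply: closureS clz => y [n _ []].
(* Injectivity of [x] makes the shift well defined. *)
have /choice [T TP] z : exists y, (exists n, y = x n) /\
    forall n, z = x n -> y = x n.+1.
  have [[n ->]|nz] := pselect (exists n, z = x n).
    by exists (x n.+1); split=> [|m /diametral_sequence_inj ->] //; exists n.+1.
  by exists (x 0%N); split=> [|m zm]; [exists 0%N|case: nz; exists m].
have Tx n : T (x n) = x n.+1 by have [_] := TP (x n); exact.
exists T; split.
- by move=> _ [z _ <-]; have [[n ->] _] := TP z; exact: star_closure_term.
- move=> A AS cA TA z Sz.
  (* For empty [A] both radii are the same default value [sup set0]. *)
  have [->|/set0P [a Aa]] := eqVneq A set0; first by rewrite /radius_at !image_set0.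
  apply: (@le_trans _ _ d).
    apply: radius_at_le; first by exists (T a), a.
    move=> _ [y Ay <-]; have [[n ->] _] := TP z; have [[m ->] _] := TP y.
    exact: Kdiam.
  apply: star_closure_radius => //; first by move=> y /AS /SK.
  have [[k Tak] _] := TP a; exists k => n /subnKC <-.
  elim: (n - k)%N => [|j IH]; first by rewrite addn0 -Tak; apply: TA; exists a.
  by rewrite addnS -Tx; apply: TA; exists (x (k + j)%N).
- move=> z Tz; have [[n Tzn] _] := TP z.
  move: (Tzn); rewrite Tz => zn; move: Tzn; rewrite zn Tx.
  by move=> /diametral_sequence_inj /eqP; rewrite eqn_leq ltnn.
Qed.

End Sequence.

End Diametral.

(** The fixed point property is applied to neither [K] nor [C] but to the closed convex set [S]
    inside [C], weakly compact as a subset of [K] and nontrivial because [x 0] and [x 1] differ. *)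
Lemma fpp_weak_normal_structure (R : realType) (X : completeNormedModType R) :
  weak_fpp_diminishing X -> weak_normal_structure X.
Proof.
move=> fpp K ntK wK cK C CK clC cC dC; apply: contrapT => nx.
have [M KM] := weakly_compact_bounded wK.
have CM x : C x -> `|x| <= M by move=> /CK; exact: KM.
have Cdiam x y : C x -> C y -> `|x - y| <= diam C by exact: diam_ge CM.
have Crad x : C x -> diam C <= radius_at x C.
  by move=> Cx; rewrite leNgt; apply/negP => rd; apply: nx; exists x.
have [a Ca] : C !=set0.
  apply/set0P/eqP => C0; move: dC; rewrite C0 /diam.
  by rewrite (_ : [set _ | _ in _ & _ in _] = set0) ?sup0 ?ltxx// -subset0 => r [].
have [x [s [s0 sS Cx Cs far]]] := diametral_sequence_exists cC dC Cdiam Crad Ca.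
have [T [TS Tdim Tfree]] :=
  fixed_point_free_shift cC CM dC Cdiam s0 sS Cx Cs far clC.
set S := star_closure C s in TS Tdim.
have Sterm n : S (x n) by exact: star_closure_term.
have [|||z _ Tz] := fpp S _ _ _ T TS Tdim; last exact: (Tfree z).
- exists (x 0%N), (x 1%N); split=> //; split=> //.
  by move=> /(diametral_sequence_inj cC dC Cdiam s0 sS Cx Cs far).
- apply: (weakly_compact_sub wK); last 2 first.
  + exact: closed_closure.
  + exact: star_closure_convex.
  move=> z clz; apply: CK; apply: clC; apply: closureS clz => y [n _ []] //.
- exact: star_closure_convex.
Qed.

Theorem theorem3p2 (R : realType) (X : completeNormedModType R) :
  weak_normal_structure X <-> weak_fpp_diminishing X.
Proof.
split; first exact: weak_normal_structure_fpp.
exact: fpp_weak_normal_structure.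
Qed.
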